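(* Let $p$ be a prime, let $V$ be a vector space over $\mathbb{Q}_p$ of dimension $n>0$, let $N$ be a norm on $V$, let $e_1,\dots,e_n$ be an $N$-orthogonal basis of $V$, let $\mathcal{L}=\mathcal{L}(\alpha_1,\dots,\alpha_m)$ be a $p$-adic lattice of rank $m\le n$ in $V$, and let $t\in V$. Throughout, write $\alpha_l=\sum_{j=1}^n a_{lj}e_j$ and $s=\sum_{j=1}^n s_je_j$ for the current vectors with respect to the current ordering of $e_1,\dots,e_n$. Consider the procedure: set $v\leftarrow0$, $s\leftarrow t$; for $i=1,\dots,m$: (a) reorder $\alpha_i,\dots,\alpha_m$ so that $N(\alpha_i)=\max_{i\le k\le m}N(\alpha_k)$; (b) if $N(s)>N(\alpha_i)$, stop the loop; (c) reorder $e_i,\dots,e_n$ so that $N(a_{ii}e_i)=\max_{i\le j\le n}N(a_{ij}e_j)$; (d) set $s\leftarrow s-\frac{s_i}{a_{ii}}\alpha_i$ and $v\leftarrow v+\frac{s_i}{a_{ii}}\alpha_i$; (e) if $s=0$, stop the loop; (f) for $l=i+1,\dots,m$ replace $\alpha_l$ by $\alpha_l-\frac{a_{li}}{a_{ii}}\alpha_i$. Output $v$. Then $v\in\mathcal{L}$ and $N(t-v)=\min_{w\in\mathcal{L}}N(t-w)$.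
   Context: A norm on a $\mathbb{Q}_p$-vector space $V$ is a function $N:V\to\mathbb{R}$ with $N(v)\ge0$, $N(v)=0$ iff $v=0$; $N(xv)=|x|_p N(v)$ for $x\in\mathbb{Q}_p$; and $N(v+w)\le\max\{N(v),N(w)\}$. A basis $e_1,\dots,e_n$ of $V$ is $N$-orthogonal if $N(\sum_i x_ie_i)=\max_i N(x_ie_i)$ for all $x_i\in\mathbb{Q}_p$. For $\mathbb{Q}_p$-linearly independent $\alpha_1,\dots,\alpha_m\in V$, the $p$-adic lattice $\mathcal{L}(\alpha_1,\dots,\alpha_m)=\{\sum_{i=1}^m a_i\alpha_i: a_i\in\mathbb{Z}_p\}$ has rank $m$. *)

(* Defs.v *)
From HB Require Import structures.
From mathcomp Require Import all_boot all_order all_algebra.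
From mathcomp Require Import generic_quotient ring_quotient perm.
From mathcomp Require Import boolp classical_sets functions reals.
From mathcomp Require Import topology normedtype sequences.

Set Implicit Arguments.
Unset Strict Implicit.
Unset Printing Implicit Defensive.

Import Order.TTheory GRing.Theory Num.Theory.
Import numFieldNormedType.Exports.

Local Open Scope ring_scope.

Section RatAbs.
Variable p : nat.

(* |0|_p = 0 and |a / b|_p = p ^ (v_p b - v_p a). *)
Definition rat_padic_abs (x : rat) : rat :=
  if x == 0 then 0
  else p%:R ^ ((logn p `|denq x|%N)%:Z - (logn p `|numq x|%N)%:Z).

Definition padic_cauchy : {pred nat -> rat} := fun u =>
  `[< forall eps : rat, 0 < eps ->
      exists n0 : nat, forall i j : nat, (n0 <= i)%N -> (n0 <= j)%N ->
        rat_padic_abs (u i - u j) < eps >].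

Hypothesis p_pr : prime p.
Local Notation abs := rat_padic_abs.

Let p_gt0 : 0 < p%:R :> rat.
Proof. by rewrite ltr0n prime_gt0. Qed.

Let p_neq0 : p%:R != 0 :> rat.
Proof. by rewrite gt_eqF. Qed.

Lemma rat_padic_abs0 : abs 0 = 0.
Proof. by rewrite /rat_padic_abs eqxx. Qed.

Lemma rat_padic_abs_ge0 x : 0 <= abs x.
Proof.
by rewrite /rat_padic_abs; case: ifP => // _; rewrite ltW // exprz_gt0.
Qed.

Lemma rat_padic_abs_eq0 x : (abs x == 0) = (x == 0).
Proof.
rewrite /rat_padic_abs; case: ifP => [|_]; first by rewrite eqxx.
by rewrite gt_eqF // exprz_gt0.
Qed.

Lemma rat_padic_abs_div (a b : int) : a != 0 -> b != 0 ->
  abs (a%:~R / b%:~R) = p%:R ^ ((logn p `|b|%N)%:Z - (logn p `|a|%N)%:Z).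
Proof.
move=> a0 b0; rewrite /rat_padic_abs mulf_eq0 invr_eq0 !intr_eq0.
rewrite (negPf a0) (negPf b0) /=.
set x := _ / _.
have x0 : x != 0 by rewrite mulf_eq0 invr_eq0 !intr_eq0 negb_or a0 b0.
have n0 : numq x != 0 by rewrite numq_eq0.
have d0 : denq x != 0 by rewrite denq_neq0.
have : a * denq x = numq x * b.
  apply: (@intr_inj rat); rewrite !intrM numqE /x.
  by rewrite mulrAC divfK ?intr_eq0.
move=> /(congr1 (fun z => logn p `|z|%N)); rewrite !abszM.
rewrite !lognM ?absz_gt0 // => h.
congr (_ ^ _); apply/eqP; rewrite subr_eq addrAC eq_sym subr_eq -!PoszD.
by rewrite addnC -h addnC.
Qed.

Lemma rat_padic_absM x y : abs (x * y) = abs x * abs y.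
Proof.
have [->|x0] := eqVneq x 0; first by rewrite mul0r rat_padic_abs0 mul0r.
have [->|y0] := eqVneq y 0; first by rewrite mulr0 rat_padic_abs0 mulr0.
rewrite -[x in LHS]divq_num_den -[y in LHS]divq_num_den mulf_div -!intrM.
have nx0 : numq x != 0 by rewrite numq_eq0.
have ny0 : numq y != 0 by rewrite numq_eq0.
rewrite rat_padic_abs_div ?mulf_neq0 ?denq_neq0 //.
rewrite /rat_padic_abs (negPf x0) (negPf y0) -expfzDr //.
rewrite !abszM !lognM ?absz_gt0 ?denq_neq0 // !PoszD.
by congr (_ ^ _); rewrite opprD addrACA.
Qed.

Lemma rat_padic_absN x : abs (- x) = abs x.
Proof. by rewrite /rat_padic_abs oppr_eq0 numqN denqN abszN. Qed.

Lemma rat_padic_absB x y : abs (x - y) = abs (y - x).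
Proof. by rewrite -opprB rat_padic_absN. Qed.

Lemma rat_padic_abs1 : abs 1 = 1.
Proof.
by rewrite -[1 in LHS]divr1 (@rat_padic_abs_div 1 1) // subrr expr0z.
Qed.

Lemma rat_padic_absV x : abs (x^-1) = (abs x)^-1.
Proof.
have [->|x0] := eqVneq x 0; first by rewrite invr0 !rat_padic_abs0 ?invr0.
apply: (@mulfI _ (abs x)); first by rewrite rat_padic_abs_eq0.
by rewrite -rat_padic_absM !divff ?rat_padic_abs1 // rat_padic_abs_eq0.
Qed.

Lemma rat_padic_absD x y : abs (x + y) <= Num.max (abs x) (abs y).
Proof.
have [->|x0] := eqVneq x 0; first by rewrite add0r le_max lexx orbT.
have [->|y0] := eqVneq y 0; first by rewrite addr0 le_max lexx.
have [->|s0] := eqVneq (x + y) 0.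
  by rewrite rat_padic_abs0 le_max rat_padic_abs_ge0.
pose a := numq x * denq y; pose b := numq y * denq x.
pose d := denq x * denq y.
have d0 : d != 0 by rewrite mulf_neq0 ?denq_neq0.
have a0 : a != 0 by rewrite mulf_neq0 ?denq_neq0 ?numq_eq0.
have b0 : b != 0 by rewrite mulf_neq0 ?denq_neq0 ?numq_eq0.
have dx0 : (denq x)%:~R != 0 :> rat by rewrite intr_eq0 denq_neq0.
have dy0 : (denq y)%:~R != 0 :> rat by rewrite intr_eq0 denq_neq0.
have ex : x = a%:~R / d%:~R.
  by rewrite !intrM -mulf_div divff // mulr1 divq_num_den.
have ey : y = b%:~R / d%:~R.
  rewrite !intrM [(denq x)%:~R * _ in X in _ / X]mulrC -mulf_div divff // mulr1.
  by rewrite divq_num_den.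
have es : x + y = (a + b)%:~R / d%:~R by rewrite {1}ex {1}ey -mulrDl intrD.
have ab0 : a + b != 0.
  by apply: contra s0 => /eqP h; rewrite es h mul0r.
rewrite es {1}ex {1}ey !rat_padic_abs_div //.
have p1 : 1 <= p%:R :> rat by rewrite ler1n prime_gt0.
have H k : (p ^ k %| `|a|)%N -> (p ^ k %| `|b|)%N -> (k <= logn p `|(a + b)%R|)%N.
  move=> ka kb; rewrite -pfactor_dvdn ?absz_gt0 //.
  have : (Posz (p ^ k) %| a + b)%Z by apply: rpredD; rewrite dvdzE.
  by rewrite dvdzE.
rewrite le_max; apply/orP.
have [hab|hba] := leqP (logn p `|a|) (logn p `|b|); [left|right].
  apply: ler_weXz2l => //; rewrite lerD2l lerN2 lez_nat; apply: H.
    by rewrite pfactor_dvdn ?absz_gt0.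
  by rewrite pfactor_dvdn ?absz_gt0.
apply: ler_weXz2l => //; rewrite lerD2l lerN2 lez_nat; apply: H.
  by rewrite pfactor_dvdn ?absz_gt0 // ltnW.
by rewrite pfactor_dvdn ?absz_gt0.
Qed.

Lemma rat_padic_absD_lt x y e : abs x < e -> abs y < e -> abs (x + y) < e.
Proof. by move=> hx hy; apply: le_lt_trans (rat_padic_absD x y) _; rewrite gt_max hx. Qed.

Lemma rat_padic_abs_eq x y : abs (x - y) < abs y -> abs x = abs y.
Proof.
move=> h; have e : x = (x - y) + y by rewrite subrK.
apply/eqP; rewrite eq_le; apply/andP; split.
  rewrite e; apply: le_trans (rat_padic_absD _ _) _.
  by rewrite ge_max lexx ltW.
have := rat_padic_absD (y - x) x; rewrite subrK le_max => /orP[|//].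
by rewrite rat_padic_absB leNgt h.
Qed.

Lemma padic_cauchy_bounded u : u \in padic_cauchy ->
  exists2 M, 0 < M & forall n, abs (u n) <= M.
Proof.
move=> /asboolP /(_ 1 ltr01) [n0 h].
exists (1 + \sum_(i < n0.+1) abs (u i)).
  by apply: ltr_wpDr => //; apply: sumr_ge0 => i _; exact: rat_padic_abs_ge0.
have le_sum k : (k <= n0)%N -> abs (u k) <= \sum_(i < n0.+1) abs (u i).
  rewrite -ltnS => kn; rewrite (bigD1 (Ordinal kn)) //= lerDl.
  by apply: sumr_ge0 => i _; exact: rat_padic_abs_ge0.
have S0 : 0 <= \sum_(i < n0.+1) abs (u i).
  by apply: sumr_ge0 => i _; exact: rat_padic_abs_ge0.
move=> n; have [/le_sum le_n|/ltnW le_n] := leqP n n0.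
  by apply: le_trans le_n _; rewrite lerDr.
rewrite -[u n](subrK (u n0)); apply: le_trans (rat_padic_absD _ _) _.
rewrite ge_max; apply/andP; split.
  by apply: le_trans (ltW (h _ _ le_n (leqnn _))) _; rewrite lerDl.
by apply: le_trans (le_sum n0 (leqnn _)) _; rewrite lerDr.
Qed.

Lemma padic_cauchy_subring : subring_closed padic_cauchy.
Proof.
split.
- apply/asboolP => e e0; exists 0%N => i j _ _.
  by rewrite subrr rat_padic_abs0.
- move=> u v /asboolP hu /asboolP hv; apply/asboolP => e e0.
  have [n1 h1] := hu e e0; have [n2 h2] := hv e e0.
  exists (maxn n1 n2) => i j; rewrite !geq_max => /andP[i1 i2] /andP[j1 j2].
  rewrite (_ : _ - _ = (u i - u j) + (v j - v i)); last first.
    by rewrite !fctE opprB addrACA [RHS]addrACA [- v i + _]addrC.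
  by apply: rat_padic_absD_lt; [exact: h1|exact: h2].
- move=> u v hu hv.
  have [M M0 hM] := padic_cauchy_bounded hu.
  have [K K0 hK] := padic_cauchy_bounded hv.
  move: hu hv => /asboolP hu /asboolP hv; apply/asboolP => e e0.
  have [n1 h1] := hu (e / K) (divr_gt0 e0 K0).
  have [n2 h2] := hv (e / M) (divr_gt0 e0 M0).
  exists (maxn n1 n2) => i j; rewrite !geq_max => /andP[i1 i2] /andP[j1 j2].
  rewrite (_ : _ - _ = u i * (v i - v j) + (u i - u j) * v j); last first.
    by rewrite !fctE mulrBr mulrBl addrA subrK.
  apply: rat_padic_absD_lt; rewrite rat_padic_absM.
    apply: (@le_lt_trans _ _ (M * abs (v i - v j))).
      by rewrite ler_wpM2r ?rat_padic_abs_ge0.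
    by rewrite mulrC -ltr_pdivlMr // h2.
  apply: (@le_lt_trans _ _ (abs (u i - u j) * K)).
    by rewrite ler_wpM2l ?rat_padic_abs_ge0.
  by rewrite -ltr_pdivlMr // h1.
Qed.

End RatAbs.

(* Q_p is the completion of Q for |.|_p: the ring of Cauchy sequences of
   rationals modulo the ideal of null sequences. *)
Section Construction.
Variables (p : nat) (p_pr : prime p).

Definition padic_cauchy_of (_ : prime p) : {pred nat -> rat} := padic_cauchy p.

HB.instance Definition _ := GRing.isSubringClosed.Build _
  (padic_cauchy_of p_pr) (padic_cauchy_subring p_pr).

Record padic_seq := PadicSeq {
  padic_seq_val :> nat -> rat;
  padic_seqP : padic_seq_val \in padic_cauchy_of p_pr }.

HB.instance Definition _ := [isSub for padic_seq_val].
HB.instance Definition _ := [Choice of padic_seq by <:].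
HB.instance Definition _ := [SubChoice_isSubComNzRing of padic_seq by <:].

Definition padic_null : {pred padic_seq} := fun u =>
  `[< forall eps : rat, 0 < eps ->
      exists n0 : nat, forall n : nat, (n0 <= n)%N ->
        rat_padic_abs p (u n) < eps >].

Lemma padic_null_ideal : idealr_closed padic_null.
Proof.
split.
- by apply/asboolP => e e0; exists 0%N => n _; rewrite rat_padic_abs0.
- apply/negP => /asboolP /(_ 1 ltr01) [n0 /(_ n0 (leqnn _))].
  by rewrite rat_padic_abs1 ltxx.
- move=> a u v /asboolP hu /asboolP hv; apply/asboolP => e e0.
  have [M M0 hM] := padic_cauchy_bounded p_pr (padic_seqP a).
  have [n1 h1] := hu (e / M) (divr_gt0 e0 M0); have [n2 h2] := hv e e0.
  exists (maxn n1 n2) => n; rewrite geq_max => /andP[i1 i2].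
  apply: rat_padic_absD_lt => //; last exact: h2.
  rewrite rat_padic_absM //.
  apply: (@le_lt_trans _ _ (M * rat_padic_abs p (u n))).
    by rewrite ler_wpM2r ?rat_padic_abs_ge0.
  by rewrite mulrC -ltr_pdivlMr // h1.
Qed.

HB.instance Definition _ := isIdealr.Build _ padic_null padic_null_ideal.

Definition Qp := {ideal_quot padic_null}.

HB.instance Definition _ := GRing.ComNzRing.on Qp.

End Construction.

Local Open Scope quotient_scope.

Section Field.
Variables (p : nat) (p_pr : prime p).
Local Notation abs := (rat_padic_abs p).
Local Notation Qp := (Qp p_pr).
Implicit Types u v : padic_seq p_pr.

Lemma padic_abs_stationary u : u \notin @padic_null p p_pr ->
  exists n0, exists2 c, 0 < c & forall n, (n0 <= n)%N -> abs (u n) = c.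
Proof.
move=> /asboolP /existsNP[e /not_implyP[e0 /forallNP h]].
have /asboolP /(_ e e0) [n0 hn0] := padic_seqP u.
have /existsNP[n /not_implyP[n0n /negP]] := h n0; rewrite -leNgt => he.
exists n0, (abs (u n)); first exact: lt_le_trans he.
by move=> i n0i; apply: rat_padic_abs_eq => //; apply: lt_le_trans he; exact: hn0.
Qed.

Lemma Qp_eqP u v : (\pi_Qp u = \pi_Qp v) <-> (u - v \in @padic_null p p_pr).
Proof. by rewrite Quotient.idealrBE; split => [->|/eqP]. Qed.

Lemma Qp_has_inverse (x : Qp) : x != 0 -> exists y : Qp, y * x = 1.
Proof.
move=> x0; pose u := repr x.
have ux : \pi_Qp u = x by rewrite reprK.
have u_nnull : u \notin @padic_null p p_pr.
  apply: contra x0 => h; rewrite -ux; apply/eqP.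
  by rewrite -(rmorph0 \pi_Qp); apply/Qp_eqP; rewrite subr0.
have [n0 [c c0 hc]] := padic_abs_stationary u_nnull.
have u_neq0 n : (n0 <= n)%N -> u n != 0.
  by move=> /hc h; rewrite -(rat_padic_abs_eq0 p_pr) h gt_eqF.
have v_cauchy : (fun n => (u n)^-1) \in padic_cauchy_of p_pr.
  have /asboolP hu := padic_seqP u.
  apply/asboolP => e e0; have [n1 h1] := hu (e * c * c) (mulr_gt0 (mulr_gt0 e0 c0) c0).
  exists (maxn n0 n1) => i j; rewrite !geq_max => /andP[i1 i2] /andP[j1 j2].
  rewrite (_ : _ - _ = (u j - u i) * (u i)^-1 * (u j)^-1); last first.
    by rewrite mulrBl divff ?u_neq0 // mulrBl mul1r mulrAC divff ?u_neq0 // mul1r.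
  rewrite !rat_padic_absM // !rat_padic_absV // !hc //.
  by rewrite !ltr_pdivrMr // h1.
exists (\pi_Qp (PadicSeq v_cauchy)); rewrite -ux -rmorphM -(rmorph1 \pi_Qp).
apply/Qp_eqP/asboolP => e e0; exists n0 => n /u_neq0 un0.
by rewrite /= !fctE /= mulVf // subrr rat_padic_abs0.
Qed.

Definition Qp_inv (x : Qp) : Qp := xget 0 [set y | y * x = 1].

Lemma Qp_mulVf (x : Qp) : x != 0 -> Qp_inv x * x = 1.
Proof. by move=> /Qp_has_inverse[y yx]; rewrite /Qp_inv; case: xgetP => [z _ //|/(_ y)]. Qed.

Lemma Qp_inv0 : Qp_inv 0 = 0.
Proof.
rewrite /Qp_inv; case: xgetP => // y _ /=; rewrite mulr0 => /eqP.
by rewrite eq_sym oner_eq0.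
Qed.

HB.instance Definition _ := GRing.ComNzRing_isField.Build Qp Qp_mulVf Qp_inv0.

End Field.

Section PadicAbs.
Variables (R : realType) (p : nat) (p_pr : prime p).
Local Notation abs := (rat_padic_abs p).
Local Notation Qp := (Qp p_pr).
Implicit Types (u v : padic_seq p_pr) (x y : Qp).
Local Open Scope classical_set_scope.

(* The extension of |.|_p to Q_p by continuity. *)
Definition padic_abs (x : Qp) : R :=
  lim ((fun n => ratr (abs (repr x n)) : R) @ \oo).

(* Z_p, the closed unit ball of Q_p. *)
Definition Zp : set Qp := [set x | padic_abs x <= 1].

Lemma padic_null_cvg u : u \in @padic_null p p_pr ->
  (fun n => ratr (abs (u n)) : R) @ \oo --> (0 : R).
Proof.
move=> /asboolP h; apply/cvgrPdist_lt => e e0.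
have [q /andP[q0 qe]] : exists q : rat, (0 < ratr q :> R) && (ratr q < e).
  have [q /[!in_itv] /= qe] := rat_in_itvoo e0.
  by exists q.
have {}q0 : 0 < q by rewrite -(ltr0q R).
have [n0 hn0] := h q q0.
exists n0 => // n /= /hn0 hn; rewrite sub0r normrN ger0_norm.
  by apply: lt_trans qe; rewrite ltr_rat.
by rewrite ler0q rat_padic_abs_ge0.
Qed.

Lemma padic_abs_cvg u :
  (fun n => ratr (abs (u n)) : R) @ \oo --> padic_abs (\pi_Qp u).
Proof.
rewrite /padic_abs; set w := repr (\pi_Qp u).
have wu : w - u \in @padic_null p p_pr.
  by apply/Qp_eqP; rewrite /w reprK.
have [u0|u0] := boolP (u \in @padic_null p p_pr).
  have w0 : w \in @padic_null p p_pr by rewrite -[w](subrK u) rpredD.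
  by rewrite (cvg_lim _ (padic_null_cvg w0)) //; exact: padic_null_cvg.
have [n0 [c c0 hc]] := padic_abs_stationary u0.
have /asboolP /(_ c c0) [n1 h1] := wu.
have hw n : (maxn n0 n1 <= n)%N -> abs (w n) = c.
  rewrite geq_max => /andP[i1 i2]; rewrite -(hc n i1).
  by apply: rat_padic_abs_eq => //; rewrite hc //; exact: h1.
have cu : (fun n => ratr (abs (u n)) : R) @ \oo --> (ratr c : R).
  apply: cvg_near_cst; exists n0 => // n /= hn; by rewrite hc.
have cw : (fun n => ratr (abs (w n)) : R) @ \oo --> (ratr c : R).
  apply: cvg_near_cst; exists (maxn n0 n1) => // n /= hn; by rewrite hw.
by rewrite (cvg_lim _ cw).
Qed.

Lemma padic_abs_ge0 x : 0 <= padic_abs x.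
Proof.
rewrite -[x]reprK; have h := @padic_abs_cvg (repr x).
rewrite -(cvg_lim _ h) //; apply: limr_ge; first by apply/cvg_ex; eexists; exact: h.
by apply: nearW => n; rewrite ler0q rat_padic_abs_ge0.
Qed.

Lemma padic_abs_eq0 x : (padic_abs x == 0) = (x == 0).
Proof.
rewrite -[x]reprK; set u := repr x; have h := @padic_abs_cvg u.
have [u0|u0] := boolP (u \in @padic_null p p_pr).
  have -> : \pi_Qp u = 0.
    by rewrite -(rmorph0 \pi_Qp); apply/Qp_eqP; rewrite subr0.
  rewrite eqxx; apply/eqP; have h0 := @padic_abs_cvg 0.
  rewrite -(rmorph0 \pi_Qp).
  apply: (cvg_unique _ h0) => //.
  by apply: padic_null_cvg; rewrite rpred0.
transitivity false; last first.
  apply/esym; apply: contraNF u0 => /eqP e.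
  by rewrite -[u]subr0; apply/Qp_eqP; rewrite e rmorph0.
have [n0 [c c0 hc]] := padic_abs_stationary u0.
suff -> : padic_abs (\pi_Qp u) = ratr c by rewrite gt_eqF // ltr0q.
apply: (cvg_unique _ h) => //.
by apply: cvg_near_cst; exists n0 => // n /= hn; rewrite hc.
Qed.

Lemma padic_absM x y : padic_abs (x * y) = padic_abs x * padic_abs y.
Proof.
rewrite -[x]reprK -[y]reprK -rmorphM; set u := repr x; set v := repr y.
have huv := @padic_abs_cvg (u * v); apply: (cvg_unique _ huv) => //.
rewrite (_ : (fun n => _) = (fun n => ratr (abs (u n)) : R) \* (fun n => ratr (abs (v n)))).
  by apply: cvgM; exact: padic_abs_cvg.
by apply/funext => n; rewrite /= -rmorphM -rat_padic_absM.
Qed.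

Lemma padic_absD x y : padic_abs (x + y) <= Num.max (padic_abs x) (padic_abs y).
Proof.
rewrite -[x]reprK -[y]reprK -rmorphD; set u := repr x; set v := repr y.
have huv := @padic_abs_cvg (u + v).
have hu := @padic_abs_cvg u; have hv := @padic_abs_cvg v.
have hm : (fun n => Num.max (ratr (abs (u n))) (ratr (abs (v n))) : R) @ \oo
    --> Num.max (padic_abs (\pi_Qp u)) (padic_abs (\pi_Qp v)).
  rewrite maxr_absE; under eq_fun do rewrite maxr_absE.
  by apply: cvgM; [apply: cvgD; [exact: cvgD|apply: cvg_norm; exact: cvgB]|exact: cvg_cst].
rewrite -(cvg_lim _ huv) // -(cvg_lim _ hm) //.
apply: ler_lim; [by apply/cvg_ex; eexists; exact: huv| |].
  by apply/cvg_ex; eexists; exact: hm.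
apply: nearW => n /=.
have : abs (u n + v n) <= Num.max (abs (u n)) (abs (v n)) by exact: rat_padic_absD.
by rewrite !le_max => /orP[h|h]; rewrite !ler_rat h ?orbT.
Qed.

Lemma padic_abs_int (z : int) : padic_abs z%:~R = ratr (abs z%:~R).
Proof.
have h := @padic_abs_cvg z%:~R; rewrite rmorph_int in h.
apply: (cvg_unique _ h) => //; apply: cvg_near_cst; apply: nearW => n.
congr (ratr (abs _)).
have e m : (m%:R : padic_seq p_pr) n = m%:R.
  by elim: m => [//|m IH]; rewrite !mulrS -IH.
by case: z {h} => m; rewrite ?NegzE ?rmorphN /= -?pmulrn -e.
Qed.

Lemma padic_abs_ratr (q : rat) : padic_abs (ratr q) = ratr (abs q).
Proof.
have d0 : ratr (abs (denq q)%:~R) != 0 :> R.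
  by rewrite fmorph_eq0 rat_padic_abs_eq0 // intr_eq0 denq_neq0.
apply: (mulIf d0); rewrite -rmorphM -rat_padic_absM //= -numqE.
rewrite -padic_abs_int -[in RHS]padic_abs_int -padic_absM /ratr divfK //.
by rewrite -padic_abs_eq0 padic_abs_int.
Qed.

End PadicAbs.

Section Lattice.
Variables (R : realType) (p : nat) (p_pr : prime p) (V : vectType (Qp p_pr)).
Local Open Scope classical_set_scope.

Record padic_norm (N : V -> R) : Prop := {
  padic_norm_ge0 : forall v, 0 <= N v;
  padic_norm_eq0 : forall v, N v = 0 <-> v = 0;
  padic_normZ : forall (x : Qp p_pr) v, N (x *: v) = padic_abs R x * N v;
  padic_normD : forall v w, N (v + w) <= Num.max (N v) (N w) }.

Definition orthogonal_basis (N : V -> R) n (e : n.-tuple V) : Prop :=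
  basis_of {:V} e /\
  forall x : 'I_n -> Qp p_pr,
    N (\sum_(i < n) x i *: tnth e i) =
    \big[Num.max/0]_(i < n) N (x i *: tnth e i).

Definition padic_lattice m (al : m.-tuple V) : set V :=
  [set v | exists2 a : 'I_m -> Qp p_pr,
     forall i, Zp R (a i) & v = \sum_(i < m) a i *: tnth al i].

End Lattice.

(* [y] is obtained from [x] by permuting the entries of index at least [i]. *)
Definition reorder_from (T : Type) k (i : nat) (x y : k.-tuple T) : Prop :=
  exists2 s : 'S_k, forall j : 'I_k, (j < i)%N -> s j = j &
    y = [tuple tnth x (s j) | j < k].

Section ClosestVector.
Variables (R : realType) (p : nat) (p_pr : prime p) (V : vectType (Qp p_pr)).
Variables (N : V -> R) (m n : nat) (le_mn : (m <= n)%N).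
Implicit Types (i l : 'I_m) (al : m.-tuple V) (e : n.-tuple V) (s v : V).

Definition max_vector i al : Prop :=
  N (tnth al i) = \big[Num.max/0]_(k < m | (i <= k)%N) N (tnth al k).

Definition max_coord i al e : Prop :=
  let term j := coord e j (tnth al i) *: tnth e j in
  N (term (widen_ord le_mn i)) =
  \big[Num.max/0]_(j < n | (i <= j)%N) N (term j).

(* (x_i / a_ii) alpha_i, where the x_j and a_ij are the coordinates of [x] and
   alpha_i in [e]. *)
Definition pivot_part i al e (x : V) : V :=
  let c := coord e (widen_ord le_mn i) in
  (c x / c (tnth al i)) *: tnth al i.

Definition eliminate i al e : m.-tuple V :=
  [tuple if (i < l)%N then tnth al l - pivot_part i al e (tnth al l)
         else tnth al l | l < m].

(* [cvp_loop k v s al e r]: when the loop is entered with (0-based) counter [k]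
   and current values [v], [s], [al], [e], it may end with [v] equal to [r].
   This is a relation because ties in the two reorderings are broken
   arbitrarily. *)
Inductive cvp_loop : nat -> V -> V -> m.-tuple V -> n.-tuple V -> V -> Prop :=
| cvp_end v s al e :
    cvp_loop m v s al e v
| cvp_stop_far i v s al e al' :
    reorder_from i al al' -> max_vector i al' ->
    N (tnth al' i) < N s ->
    cvp_loop i v s al e v
| cvp_stop_exact i v s al e al' e' :
    reorder_from i al al' -> max_vector i al' ->
    N s <= N (tnth al' i) ->
    reorder_from i e e' -> max_coord i al' e' ->
    s - pivot_part i al' e' s = 0 ->
    cvp_loop i v s al e (v + pivot_part i al' e' s)
| cvp_next i v s al e al' e' r :
    reorder_from i al al' -> max_vector i al' ->
    N s <= N (tnth al' i) ->
    reorder_from i e e' -> max_coord i al' e' ->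
    s - pivot_part i al' e' s <> 0 ->
    cvp_loop i.+1 (v + pivot_part i al' e' s) (s - pivot_part i al' e' s)
      (eliminate i al' e') e' r ->
    cvp_loop i v s al e r.

Definition cvp_output (t : V) al e (r : V) : Prop := cvp_loop 0 0 t al e r.

End ClosestVector.

(* Main.v *)
(** The residual [s] and the basis keep an echelon shape: the coordinates of [s]
    before the counter vanish, each processed [alpha_j] has no coordinate before
    [j], and its norm is carried by its [j]-th (pivot) coordinate. The choice of
    the pivot as a largest coordinate of a longest vector makes all quotients
    [s_i / a_ii] and [a_li / a_ii] integral, so the lattice never changes. When
    the loop stops, adding to [s] a combination of processed vectors in which some
    term has norm at least [N s] leaves a pivot coordinate of norm at least [N s],
    and all other lattice vectors are shorter than [s]; hence [0] is a lattice
    vector closest to [s]. *)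
Require Import Defs.
From mathcomp Require Import all_boot all_order all_algebra.
From mathcomp Require Import perm classical_sets reals.

Set Implicit Arguments.
Unset Strict Implicit.

Import Order.TTheory GRing.Theory Num.Theory.
Local Open Scope ring_scope.

(** * The absolute value at 0, 1 and -1 *)

Lemma padic_abs1 (R : realType) (p : nat) (p_pr : prime p) :
  padic_abs R (1 : Qp p_pr) = 1.
Proof. by have := padic_abs_int R p_pr 1; rewrite mulr1z [_%:~R]mulr1z rat_padic_abs1 // rmorph1. Qed.

Lemma padic_absN1 (R : realType) (p : nat) (p_pr : prime p) :
  padic_abs R (-1 : Qp p_pr) = 1.
Proof.
have := padic_abs_int R p_pr (-1).
by rewrite !rmorphN1 rat_padic_absN rat_padic_abs1 // rmorph1.
Qed.

Lemma padic_abs0 (R : realType) (p : nat) (p_pr : prime p) :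
  padic_abs R (0 : Qp p_pr) = 0.
Proof. by apply/eqP; rewrite padic_abs_eq0. Qed.

(** * Ultrametric estimates for norms *)

Section Norm.
Variables (R : realType) (p : nat) (p_pr : prime p) (V : vectType (Qp p_pr)).
Variables (N : V -> R) (N_norm : padic_norm N).

Lemma norm0 : N 0 = 0.
Proof. exact/(padic_norm_eq0 N_norm). Qed.

Lemma normN v : N (- v) = N v.
Proof. by rewrite -scaleN1r (padic_normZ N_norm) padic_absN1 mul1r. Qed.

Lemma norm_sum_le (I : finType) (P : pred I) (F : I -> V) B :
  0 <= B -> (forall i, P i -> N (F i) <= B) -> N (\sum_(i | P i) F i) <= B.
Proof.
move=> B0 FB; apply: (big_ind (fun v => N v <= B)) => //; first by rewrite norm0.
move=> v w vB wB; apply: le_trans (padic_normD N_norm v w) _.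
by rewrite ge_max vB.
Qed.

Lemma norm_sum_lt (I : finType) (P : pred I) (F : I -> V) B :
  0 < B -> (forall i, P i -> N (F i) < B) -> N (\sum_(i | P i) F i) < B.
Proof.
move=> B0 FB; apply: (big_ind (fun v => N v < B)) => //; first by rewrite norm0.
move=> v w vB wB; apply: le_lt_trans (padic_normD N_norm v w) _.
by rewrite gt_max vB.
Qed.

Lemma norm_le_Zp (x : Qp p_pr) v : Defs.Zp R x -> N (x *: v) <= N v.
Proof.
move=> x1; rewrite (padic_normZ N_norm) ler_piMl //.
exact: (padic_norm_ge0 N_norm).
Qed.

Lemma orthogonal_basis_coord_le n (e : n.-tuple V) : orthogonal_basis N e ->
  forall v j, N (coord e j v *: tnth e j) <= N v.
Proof.
move=> [e_basis e_orth] v j.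
have vE : v = \sum_(i < n) coord e i v *: tnth e i.
  rewrite [LHS](coord_basis e_basis) ?memvf //.
  by apply: eq_bigr => i _; rewrite -tnth_nth.
rewrite [v in leRHS]vE e_orth.
exact: (le_bigmax _ (fun i => N (coord e i v *: tnth e i))).
Qed.

End Norm.

(** * Lattices as modules over the p-adic integers *)

Section LatticeTheory.
Variables (R : realType) (p : nat) (p_pr : prime p) (V : vectType (Qp p_pr)).
Variable (m : nat).
Implicit Types (al : m.-tuple V).
Local Notation L := (padic_lattice R).

Lemma padic_lattice0 al : L al 0.
Proof.
exists (fun _ => 0); first by move=> i; rewrite /Defs.Zp /= padic_abs0.
by rewrite big1 // => i _; rewrite scale0r.
Qed.

Lemma padic_latticeD al v w : L al v -> L al w -> L al (v + w).
Proof.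
move=> [a a1 ->] [b b1 ->]; exists (fun i => a i + b i).
  move=> i; apply: le_trans (padic_absD R _ _) _.
  by rewrite ge_max; apply/andP; split; [exact: a1 | exact: b1].
by rewrite -big_split; apply: eq_bigr => i _; rewrite scalerDl.
Qed.

Lemma padic_latticeZ al x v : Defs.Zp R x -> L al v -> L al (x *: v).
Proof.
move=> x1 [a a1 ->]; exists (fun i => x * a i).
  move=> i; rewrite /Defs.Zp /= padic_absM.
  by apply: mulr_ile1; rewrite ?padic_abs_ge0 //; exact: a1.
by rewrite scaler_sumr; apply: eq_bigr => i _; rewrite scalerA.
Qed.

Lemma padic_latticeB al v w : L al v -> L al w -> L al (v - w).
Proof.
move=> Lv Lw; apply: padic_latticeD => //; rewrite -scaleN1r.
by apply: padic_latticeZ => //; rewrite /Defs.Zp /= padic_absN1.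
Qed.

Lemma padic_lattice_gen al i : L al (tnth al i).
Proof.
exists (fun j => (j == i)%:R).
  by move=> j; rewrite /Defs.Zp /=; case: eqP => _; rewrite ?padic_abs1 ?padic_abs0.
rewrite (bigD1 i) //= eqxx scale1r big1 ?addr0 // => j /negPf ->.
by rewrite scale0r.
Qed.

Lemma padic_lattice_sub k (be : k.-tuple V) al :
  (forall i, L al (tnth be i)) -> forall v, L be v -> L al v.
Proof.
move=> be_al v [a a1 ->]; apply: (big_ind (L al)).
- exact: padic_lattice0.
- by move=> *; exact: padic_latticeD.
- by move=> i _; apply: padic_latticeZ => //; exact: a1.
Qed.

Lemma reorder_padic_lattice i al al' : reorder_from i al al' -> L al' = L al.
Proof.
move=> [s _ ->]; apply/seteqP; split; apply: padic_lattice_sub => l.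
  by rewrite tnth_mktuple; exact: padic_lattice_gen.
(* The old generator [tnth al l] stands at index [s^-1 l] of the reordered tuple. *)
by have := padic_lattice_gen [tuple tnth al (s j) | j < m] ((s^-1)%g l);
  rewrite tnth_mktuple permKV.
Qed.

End LatticeTheory.

(** * Permutations fixing an initial segment of indices *)

Section Reorder.
Variables (R : realType) (k : nat).

(** If [s l] were below [i], it would be fixed by [s], and injectivity would give [s l = l]. *)
Lemma perm_fix_ge i (s : 'S_k) : (forall j : 'I_k, (j < i)%N -> s j = j) ->
  forall l : 'I_k, (i <= l)%N -> (i <= s l)%N.
Proof.
move=> s_fix l il; rewrite leqNgt; apply/negP => sli.
by have /perm_inj sl := s_fix _ sli; rewrite sl ltnNge il in sli.
Qed.

(** A single transposition does it: swap [i] with an index where [F] is largest among those from [i]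
    on. Since the iterated maximum starts at 0, the values must be nonnegative. *)
Lemma exists_perm_max (F : 'I_k -> R) (i : 'I_k) : (forall j, 0 <= F j) ->
  exists2 s : 'S_k, (forall j : 'I_k, (j < i)%N -> s j = j) &
    F (s i) = \big[Num.max/0]_(j < k | (i <= j)%N) F (s j).
Proof.
move=> F0.
pose j0 := [arg max_(j > i | (i <= j)%N) F j]%O.
have [ij0 Fmax] : (i <= j0)%N /\ forall j : 'I_k, (i <= j)%N -> F j <= F j0.
  by rewrite /j0; case: arg_maxP.
have s_fix (j : 'I_k) : (j < i)%N -> tperm i j0 j = j.
  move=> ji; rewrite tpermD //; apply: contraTneq ji => <-; rewrite -leqNgt //.
exists (tperm i j0) => //; rewrite tpermL; apply/eqP; rewrite eq_le.
apply/andP; split; first by rewrite -{1}(tpermL i j0) le_bigmax_cond.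
by apply: bigmax_le => // j ij; apply: Fmax; exact: perm_fix_ge.
Qed.

Lemma reorder_from_lt (T : Type) i (x y : k.-tuple T) (j : 'I_k) :
  reorder_from i x y -> (j < i)%N -> tnth y j = tnth x j.
Proof. by move=> [s s_fix ->] ji; rewrite tnth_mktuple s_fix. Qed.

End Reorder.

(** * Loop invariants and the stopping criterion *)

Section Algorithm.
Variables (R : realType) (p : nat) (p_pr : prime p) (V : vectType (Qp p_pr)).
Variables (N : V -> R) (N_norm : padic_norm N).
Variables (m n : nat) (le_mn : (m <= n)%N).
Implicit Types (i j l : 'I_m) (al : m.-tuple V) (e : n.-tuple V) (s v : V).
Local Notation L := (padic_lattice R).
Local Notation w := (widen_ord le_mn).

Lemma reorder_basis k e e' :
  reorder_from k e e' -> basis_of {:V} e -> basis_of {:V} e'.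
Proof.
move=> [s _ ->] e_basis; rewrite (perm_basis (Y := e)) //.
by apply/tuple_permP; exists s.
Qed.

Lemma coord_reorder e (s : 'S_n) (j : 'I_n) v : basis_of {:V} e ->
  coord [tuple tnth e (s l) | l < n] j v = coord e (s j) v.
Proof.
move=> e_basis; set e' := [tuple _ | _ < n].
have e'_basis : basis_of {:V} e' by apply: (@reorder_basis 0 e) => //; exists s.
have vE : v = \sum_(l < n) coord e (s l) v *: e'`_l.
  rewrite [LHS](coord_basis e_basis) ?memvf // (reindex_inj (@perm_inj _ s)).
  by apply: eq_bigr => l _; rewrite -!tnth_nth tnth_mktuple.
by rewrite [in LHS]vE coord_sum_free // (basis_free e'_basis).
Qed.

(* The half of orthogonality that is not automatic: the maximum of the terms of
   an expansion in [e] is at most the norm of the sum. *)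
Definition coord_bounded e : Prop := basis_of {:V} e /\
  forall v (j : 'I_n), N (coord e j v *: tnth e j) <= N v.

(** By the first clause, a bound on the pivot term of a multiple of [alpha_j] bounds the whole
    multiple. The second clause also covers the unprocessed vectors, so subtracting multiples of
    them later does not disturb coordinate [j]. *)
Definition echelon k al e : Prop := forall j, (j < k)%N ->
  N (tnth al j) = N (coord e (w j) (tnth al j) *: tnth e (w j)) /\
  forall l, (j < l)%N -> coord e (w j) (tnth al l) = 0.

Definition coords_vanish k e s : Prop :=
  forall j, (j < k)%N -> coord e (w j) s = 0.

Definition closest_in al s u : Prop :=
  L al u /\ forall x, L al x -> N (s - u) <= N (s - x).

(** Translation by [q] maps the lattice onto itself, so a competitor [x] for [s] becomes the
    competitor [x - q] for [s - q]. *)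
Lemma closest_in_shift al s q u : L al q -> closest_in al (s - q) u ->
  closest_in al s (q + u).
Proof.
move=> Lq [Lu u_min]; split; first exact: padic_latticeD.
move=> x Lx; rewrite opprD addrA.
by have := u_min (x - q) (padic_latticeB Lx Lq); rewrite opprB addrA subrK.
Qed.

(* If [N (s - x) < N s] for [x = \sum b_j alpha_j], the coordinate [j] of
   [s - x] shows by induction on [j < k] that [N (b_j alpha_j) < N s]; then
   [N x < N s], against the ultrametric inequality. *)
Lemma echelon_closest0 k al e s :
  coord_bounded e -> echelon k al e -> coords_vanish k e s ->
  (forall l, (k <= l)%N -> N (tnth al l) < N s) -> closest_in al s 0.
Proof.
move=> [e_basis e_le] ech s0 al_lt; split; first exact: padic_lattice0.
move=> x [b b1 ->]; rewrite subr0 leNgt; apply/negP.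
set x' := \sum_(i < m) _ => lt_s.
have s_gt0 : 0 < N s by apply: le_lt_trans lt_s; exact: padic_norm_ge0 N_norm _.
(* The bound [q] makes this a strong induction on [j]. *)
have head q : forall j, (j < q)%N -> (j < k)%N -> N (b j *: tnth al j) < N s.
  elim: q => // q IH j; rewrite ltnS => jq jk.
  have [al_j al0] := ech j jk.
  rewrite (padic_normZ N_norm) al_j -(padic_normZ N_norm).
  set c := coord e (w j); set ej := tnth e (w j).
  (* In coordinate [j] the vector [s] vanishes, and so does every lattice generator after [alpha_j];
     only the indices [l <= j] contribute. *)
  have cE : c (s - x') =
      - (b j * c (tnth al j)) - \sum_(l < m | (l < j)%N) b l * c (tnth al l).
    rewrite /c linearB /= s0 // sub0r -opprD; congr (- _).
    rewrite linear_sum (bigD1 j) //= linearZ; congr (_ + _).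
    rewrite (bigID (fun l : 'I_m => (l < j)%N)) /=.
    rewrite [X in _ + X]big1 ?addr0 => [|l /andP[lj jl]]; last first.
      rewrite linearZ /= al0 ?mulr0 // ltn_neqAle leqNgt jl andbT.
      by rewrite eq_sym.
    rewrite (eq_bigl (fun l : 'I_m => (l < j)%N)) => [|l].
      by apply: eq_bigr => l _; rewrite linearZ.
    by rewrite andb_idl // => lj; rewrite neq_ltn lj.
  have -> : b j *: (c (tnth al j) *: ej) =
      - (c (s - x') *: ej) - \sum_(l < m | (l < j)%N) b l *: (c (tnth al l) *: ej).
    rewrite cE scalerBl scaleNr opprB opprK scalerA scaler_suml.
    by under [in RHS]eq_bigr do rewrite -scalerA; rewrite addrAC subrr add0r.
  apply: le_lt_trans (padic_normD N_norm _ _) _.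
  rewrite !normN // gt_max; apply/andP; split.
    by apply: le_lt_trans lt_s; exact: e_le.
  apply: norm_sum_lt => // l lj.
  apply: le_lt_trans (IH l (leq_trans lj jq) (ltn_trans lj jk)).
  rewrite !(padic_normZ N_norm (b l)); apply: ler_wpM2l; last exact: e_le.
  exact: padic_abs_ge0.
have x_lt : N x' < N s.
  apply: norm_sum_lt => // l _; have [lk|kl] := ltnP l k.
    exact: (head l.+1).
  by apply: le_lt_trans (al_lt l kl); apply: norm_le_Zp => //; exact: b1.
have := padic_normD N_norm (s - x') x'.
by rewrite subrK le_max leNgt lt_s leNgt x_lt.
Qed.

(** Indices below [k] are fixed, so the processed vectors, their basis vectors and the corresponding
    coordinate forms stay the same. The unprocessed vectors are permuted among themselves, which
    preserves their vanishing coordinates. *)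
Lemma reorder_invariants k al al' e e' :
  reorder_from k al al' -> reorder_from k e e' ->
  coord_bounded e -> echelon k al e ->
  [/\ coord_bounded e', echelon k al' e' &
      forall s, coords_vanish k e s -> coords_vanish k e' s].
Proof.
move=> r_al r_e [e_basis e_le] ech.
have e'_basis := reorder_basis r_e e_basis.
have e'_lt j : (j < k)%N -> tnth e' (w j) = tnth e (w j).
  by move=> jk; exact: (reorder_from_lt (j := w j) r_e jk).
have c'_lt j v : (j < k)%N -> coord e' (w j) v = coord e (w j) v.
  by case: r_e => [s s_fix ->] jk; rewrite coord_reorder // s_fix.
split.
- split=> // v j; case: r_e => [s _ ->].
  by rewrite coord_reorder // tnth_mktuple; exact: e_le.
- move=> j jk; have [al_j al0] := ech j jk.
  rewrite (reorder_from_lt r_al jk) c'_lt // e'_lt //; split=> // l jl.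
  case: r_al => [s s_fix ->]; rewrite c'_lt // tnth_mktuple al0 //.
  have [lk|kl] := ltnP l k; first by rewrite s_fix.
  exact: leq_trans jk (perm_fix_ge s_fix kl).
- by move=> s s0 j jk; rewrite c'_lt // s0.
Qed.

(** * The pivot and its integral quotients *)

Section Pivot.
Variables (i : 'I_m) (al : m.-tuple V) (e : n.-tuple V).
Hypotheses (e_bd : coord_bounded e) (ech : echelon i al e).
Hypothesis (al_max : max_coord N le_mn i al e).
Local Notation c := (coord e (w i)).

(** Coordinates of [alpha_i] before [i] vanish by the echelon shape, and the later terms are at most
    the pivot term; the ultrametric inequality then bounds [alpha_i] by its pivot term. *)
Lemma pivot_norm : N (tnth al i) = N (c (tnth al i) *: tnth e (w i)).
Proof.
have [e_basis e_le] := e_bd.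
apply/eqP; rewrite eq_le e_le andbT.
rewrite [X in N X <= _](coord_basis e_basis) ?memvf //.
apply: norm_sum_le => // [|j _]; first exact: padic_norm_ge0 N_norm _.
rewrite -tnth_nth; have [ij|ji] := leqP i j.
  move: al_max; rewrite /max_coord /= => ->.
  exact: (le_bigmax_cond _ (fun j : 'I_n => N (coord e j (tnth al i) *: tnth e j))).
pose j' := Ordinal (ltn_trans ji (ltn_ord i)).
have -> : j = w j' by exact: val_inj.
rewrite (proj2 (@ech j' ji)) // scale0r norm0 //.
exact: padic_norm_ge0 N_norm _.
Qed.

(** Both coordinates belong to the same basis vector, whose norm is positive and cancels from the
    comparison of the two terms. *)
Lemma pivot_abs_le v : N v <= N (tnth al i) ->
  padic_abs R (c v) <= padic_abs R (c (tnth al i)).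
Proof.
have [e_basis e_le] := e_bd.
move=> /(le_trans (e_le v (w i))); rewrite pivot_norm !(padic_normZ N_norm).
rewrite ler_pM2r // lt_neqAle (padic_norm_ge0 N_norm) andbT eq_sym.
apply/eqP => /(padic_norm_eq0 N_norm) ei0.
have /free_not0 := basis_free e_basis.
by move=> /(_ _ (mem_tnth (w i) e)); rewrite ei0 eqxx.
Qed.

Lemma pivot_coeff_Zp v : N v <= N (tnth al i) ->
  Defs.Zp R (c v / c (tnth al i)).
Proof.
move=> /pivot_abs_le v_le; rewrite /Defs.Zp /=.
(* For a zero pivot the inverse is 0 by convention, and the quotient 0 is integral. *)
have [->|a0] := eqVneq (c (tnth al i)) 0.
  by rewrite invr0 mulr0 padic_abs0.
have a_gt0 : 0 < padic_abs R (c (tnth al i)).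
  by rewrite lt_neqAle padic_abs_ge0 eq_sym padic_abs_eq0 a0.
by rewrite -(ler_pM2r a_gt0) -padic_absM divfK // mul1r.
Qed.

Lemma pivot_part_lattice v : N v <= N (tnth al i) ->
  L al (pivot_part le_mn i al e v).
Proof.
move=> /pivot_coeff_Zp v1; apply: padic_latticeZ => //.
exact: padic_lattice_gen.
Qed.

Lemma pivot_part_coords v : N v <= N (tnth al i) -> coords_vanish i e v ->
  coords_vanish i.+1 e (v - pivot_part le_mn i al e v).
Proof.
move=> v_le v0 j; rewrite ltnS leq_eqVlt => /orP[/eqP/val_inj -> | ji].
  rewrite linearB linearZ /=; have := pivot_abs_le v_le.
  (* If the pivot is zero, nothing is subtracted, but [pivot_abs_le] already forces the coordinate
     of [v] to be zero. *)
  have [->|a0] := eqVneq (c (tnth al i)) 0; last by rewrite divfK // subrr.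
  rewrite padic_abs0 mulr0 subr0 => h; apply/eqP.
  by rewrite -(padic_abs_eq0 R) eq_le h padic_abs_ge0.
by rewrite linearB linearZ /= v0 // (proj2 (ech ji)) // mulr0 subrr.
Qed.

Hypothesis (i_max : forall l, (i <= l)%N -> N (tnth al l) <= N (tnth al i)).

(** The vector [alpha_i] itself is kept and the others change by integral multiples of it, so the
    change of generators can be undone over the p-adic integers. *)
Lemma eliminate_lattice : L (eliminate le_mn i al e) = L al.
Proof.
apply/seteqP; split; apply: padic_lattice_sub => l.
  rewrite tnth_mktuple; case: ifP => il; last exact: padic_lattice_gen.
  apply: padic_latticeB; first exact: padic_lattice_gen.
  by apply: pivot_part_lattice; apply: i_max; exact: ltnW.
have gen := padic_lattice_gen R (eliminate le_mn i al e).
have := gen l; rewrite tnth_mktuple; case: ifP => // il.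
rewrite -[X in _ -> L _ X](subrK (pivot_part le_mn i al e (tnth al l))) => Ll.
apply: padic_latticeD => //; apply: padic_latticeZ.
  by apply: pivot_coeff_Zp; apply: i_max; exact: ltnW.
by have := gen i; rewrite tnth_mktuple ltnn.
Qed.

Lemma eliminate_echelon : echelon i.+1 (eliminate le_mn i al e) e.
Proof.
move=> j; rewrite ltnS => ji; rewrite !tnth_mktuple ltnNge ji /=; split.
  move: ji; rewrite leq_eqVlt => /orP[/eqP/val_inj -> | ji].
    exact: pivot_norm.
  exact: (proj1 (ech ji)).
move=> l jl; rewrite tnth_mktuple; case: ifP => il.
  apply: pivot_part_coords => //; first by apply: i_max; exact: ltnW.
  by move=> k ki; apply: (proj2 (ech ki)); exact: ltn_trans il.
have ji' : (j < i)%N by apply: leq_trans jl _; rewrite leqNgt il.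
exact: (proj2 (ech ji')).
Qed.

End Pivot.

(** * Correctness of every run *)

Lemma max_vector_le i al : max_vector N i al ->
  forall l, (i <= l)%N -> N (tnth al l) <= N (tnth al i).
Proof.
by move=> -> l il; exact: (le_bigmax_cond _ (fun k => N (tnth al k))).
Qed.

Lemma closest_in_eq al al' s u : L al' = L al ->
  closest_in al' s u -> closest_in al s u.
Proof. by rewrite /closest_in => ->. Qed.

(** The claim is relative to the current residual and lattice: [r - v] is the part of the output
    still to be collected. This form lets the induction follow the run. *)
Lemma cvp_loop_closest k v s al e r : cvp_loop N le_mn k v s al e r ->
  coord_bounded e -> echelon k al e -> coords_vanish k e s ->
  closest_in al s (r - v).
Proof.
elim=> {k v s al e r}.
- move=> v s al e e_bd ech s0; rewrite subrr.
  by apply: echelon_closest0 ech s0 _ => // l; rewrite leqNgt ltn_ord.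
- move=> i v s al e al' r_al al_max far e_bd ech s0; rewrite subrr.
  (* This stop occurs before the basis is reordered, so the identity serves as its reordering. *)
  have r_e : reorder_from i e e.
    exists 1%g => [j _|]; first by rewrite perm1.
    by apply: eq_from_tnth => j; rewrite tnth_mktuple perm1.
  have [_ ech' _] := reorder_invariants r_al r_e e_bd ech.
  apply: closest_in_eq (reorder_padic_lattice R r_al) _.
  apply: echelon_closest0 ech' s0 _ => // l il.
  by apply: le_lt_trans far; exact: max_vector_le.
- move=> i v s al e al' e' r_al al_max near r_e e_max exact_s e_bd ech s0.
  have [e_bd' ech' _] := reorder_invariants r_al r_e e_bd ech.
  apply: closest_in_eq (reorder_padic_lattice R r_al) _.
  rewrite [v + _]addrC addrK; split; first exact: pivot_part_lattice.
  by move=> x _; rewrite exact_s norm0 //; exact: padic_norm_ge0 N_norm _.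
move=> i v s al e al' e' r r_al al_max near r_e e_max _ _ IH e_bd ech s0.
have [e_bd' ech' s0'] := reorder_invariants r_al r_e e_bd ech.
apply: closest_in_eq (reorder_padic_lattice R r_al) _.
(* The remaining output splits into the multiple of [alpha_i] collected in this pass and what the
   later passes collect. *)
have -> : r - v = pivot_part le_mn i al' e' s
    + (r - (v + pivot_part le_mn i al' e' s)).
  by rewrite [RHS]addrC opprD addrA subrK.
apply: closest_in_shift; first exact: pivot_part_lattice.
have i_max := max_vector_le al_max.
apply: closest_in_eq (eliminate_lattice e_bd' ech' e_max i_max) _.
apply: IH => //; first exact: eliminate_echelon.
by apply: pivot_part_coords => //; exact: s0'.
Qed.

(** * Existence of a run *)

Lemma exists_max_vector i al :
  exists2 al', reorder_from i al al' & max_vector N i al'.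
Proof.
have [s s_fix s_max] := @exists_perm_max R m (fun l => N (tnth al l)) i
  (fun _ => padic_norm_ge0 N_norm _).
exists [tuple tnth al (s l) | l < m]; first by exists s.
rewrite /max_vector tnth_mktuple s_max.
by apply: eq_bigr => l _; rewrite tnth_mktuple.
Qed.

Lemma exists_max_coord i al e : basis_of {:V} e ->
  exists2 e', reorder_from i e e' & max_coord N le_mn i al e'.
Proof.
move=> e_basis; pose F (j : 'I_n) := N (coord e j (tnth al i) *: tnth e j).
have [s s_fix s_max] := @exists_perm_max R n F (w i)
  (fun _ => padic_norm_ge0 N_norm _).
exists [tuple tnth e (s j) | j < n]; first by exists s.
rewrite /max_coord /= coord_reorder // tnth_mktuple [LHS]s_max.
by apply: eq_bigr => l _; rewrite coord_reorder // tnth_mktuple.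
Qed.

(** Induction on the number [d] of passes left. As the loop is a relation, this is what keeps the
    correctness claim from being vacuous. *)
Lemma cvp_loop_exists d k v s al e : (k + d = m)%N -> basis_of {:V} e ->
  exists r, cvp_loop N le_mn k v s al e r.
Proof.
elim: d k v s al e => [|d IH] k v s al e.
  by rewrite addn0 => -> _; exists v; exact: cvp_end.
move=> kd e_basis.
have km : (k < m)%N by rewrite -kd addnS ltnS leq_addr.
have [al' r_al al_max] := exists_max_vector (Ordinal km) al.
have [far|near] := ltP (N (tnth al' (Ordinal km))) (N s).
  by exists v; exact: (@cvp_stop_far _ _ _ _ _ _ _ _ (Ordinal km) _ _ _ _ al').
have [e' r_e e_max] := exists_max_coord (Ordinal km) al' e_basis.
have [s0|s_neq0] := eqVneq (s - pivot_part le_mn (Ordinal km) al' e' s) 0.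
  eexists; exact: (@cvp_stop_exact _ _ _ _ _ _ _ _ (Ordinal km) _ _ _ _ al' e').
have [r hr] := IH k.+1 (v + pivot_part le_mn (Ordinal km) al' e' s)
  (s - pivot_part le_mn (Ordinal km) al' e' s)
  (eliminate le_mn (Ordinal km) al' e') e'
  (etrans (addSnnS k d) kd) (reorder_basis r_e e_basis).
exists r.
apply: (@cvp_next _ _ _ _ _ _ _ _ (Ordinal km) _ _ _ _ al' e') => //.
exact/eqP.
Qed.

End Algorithm.

Theorem theorem7p1 (R : realType) (p : nat) (p_pr : prime p)
    (V : vectType (Qp p_pr)) (n : nat) (n_gt0 : (0 < n)%N)
    (dimV : \dim {:V} = n)
    (N : V -> R) (N_norm : padic_norm N)
    (e : n.-tuple V) (e_orth : orthogonal_basis N e)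
    (m : nat) (le_mn : (m <= n)%N)
    (alpha : m.-tuple V) (alpha_free : free alpha) (t : V) :
  (exists v : V, cvp_output N le_mn t alpha e v) /\
  (forall v : V, cvp_output N le_mn t alpha e v ->
     padic_lattice R alpha v /\
     forall w : V, padic_lattice R alpha w -> N (t - v) <= N (t - w)).
Proof.
split; first exact: (cvp_loop_exists N_norm le_mn 0 t alpha (add0n m) (proj1 e_orth)).
(* The loop starts with accumulator 0, hence [v - 0]; at counter 0 the echelon and vanishing
   conditions are empty. *)
move=> v out; rewrite -[v]subr0.
apply: (cvp_loop_closest N_norm out) => //.
by split; [case: e_orth | exact: orthogonal_basis_coord_le].
Qed.
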